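(* Let $d>1$ and let $F(\mathbf{x})\in\mathbb{Z}[x_1,\ldots,x_n]$ be a homogeneous form of degree $d$. Define the bihomogeneous form $G(\mathbf{x};\mathbf{y})=F(x_1y_1,\ldots,x_ny_n)$ in $\mathbf{x}=(x_1,\ldots,x_n)$, $\mathbf{y}=(y_1,\ldots,y_n)$. Then $$\min\{\operatorname{codim}V^*_{G,1},\operatorname{codim}V^*_{G,2}\}\ge\frac{\operatorname{codim}V_F^*}{2}.$$
   Context: $V_F^*=\{\mathbf{z}\in\mathbb{C}^n:\partial F/\partial x_j(\mathbf{z})=0\ (1\le j\le n)\}\subseteq\mathbb{A}^n_{\mathbb{C}}$ with $\operatorname{codim}V_F^*=n-\dim V_F^*$. $V^*_{G,1}=\{(\mathbf{x},\mathbf{y})\in\mathbb{C}^{2n}:\partial G/\partial x_j(\mathbf{x},\mathbf{y})=0\ (1\le j\le n)\}$ and $V^*_{G,2}=\{(\mathbf{x},\mathbf{y})\in\mathbb{C}^{2n}:\partial G/\partial y_j(\mathbf{x},\mathbf{y})=0\ (1\le j\le n)\}$, affine varieties in $\mathbb{A}^{2n}_{\mathbb{C}}$ with codimension $2n-\dim$. *)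

(* Defs.v *)
From HB Require Import structures.
From mathcomp Require Import all_boot all_order all_algebra.
From mathcomp Require Import boolp reals.
From mathcomp Require Import complex.
From mathcomp Require Import mpoly.
Set Implicit Arguments.
Unset Strict Implicit.
Unset Printing Implicit Defensive.
Import Order.TTheory GRing.Theory Num.Theory.
Local Open Scope ring_scope.

Section AffineVarieties.
Variable K : fieldType.

Definition aff_pt (m : nat) := 'I_m -> K.

Definition zero_locus (m : nat) (S : {mpoly K[m]} -> Prop) : aff_pt m -> Prop :=
  fun x => forall p, S p -> p.@[x] = 0.

Definition aff_subset (m : nat) (A B : aff_pt m -> Prop) : Prop :=
  forall x, A x -> B x.

Definition zclosed (m : nat) (V : aff_pt m -> Prop) : Prop :=
  exists S : {mpoly K[m]} -> Prop, forall x, V x <-> zero_locus S x.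

Definition zirreducible (m : nat) (Z : aff_pt m -> Prop) : Prop :=
  [/\ zclosed Z, exists x, Z x &
      forall Z1 Z2 : aff_pt m -> Prop, zclosed Z1 -> zclosed Z2 ->
        (forall x, Z x -> Z1 x \/ Z2 x) ->
        aff_subset Z Z1 \/ aff_subset Z Z2].

Definition irr_chain (m : nat) (V : aff_pt m -> Prop) (k : nat) : Prop :=
  exists Z : nat -> aff_pt m -> Prop,
    (forall i, (i <= k)%N -> zirreducible (Z i) /\ aff_subset (Z i) V) /\
    (forall i, (i < k)%N ->
       aff_subset (Z i) (Z i.+1) /\ exists x, Z i.+1 x /\ ~ Z i x).

(* (Krull) dimension of V in affine m-space: the maximal length of a chain of
   irreducible closed subsets of V.  Such lengths never exceed m, so the max
   is taken over k <= m.  (For V empty this gives 0 instead of -1; this case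
   does not occur below.) *)
Definition zdim (m : nat) (V : aff_pt m -> Prop) : nat :=
  \max_(k < m.+1 | `[< irr_chain V k >]) k.

Definition zcodim (m : nat) (V : aff_pt m -> Prop) : nat := (m - zdim V)%N.

End AffineVarieties.

Definition mpoly_intK (K : nzRingType) (n : nat) (F : {mpoly int[n]}) : {mpoly K[n]} :=
  map_mpoly (fun z : int => z%:~R) F.

Definition VFstar (K : fieldType) (n : nat) (F : {mpoly int[n]}) : aff_pt K n -> Prop :=
  zero_locus (fun p => exists j : 'I_n, p = (mpoly_intK K F)^`M(j)).

(* G(x;y) = F(x_1 y_1, ..., x_n y_n), variables x_i = 'X_(lshift n i),
   y_i = 'X_(rshift n i) in 2n variables *)
Definition Gform (n : nat) (F : {mpoly int[n]}) : {mpoly int[n + n]} :=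
  F \mPo [tuple ('X_(lshift n i) * 'X_(rshift n i) : {mpoly int[n + n]}) | i < n].

Definition VGstar1 (K : fieldType) (n : nat) (F : {mpoly int[n]}) : aff_pt K (n + n) -> Prop :=
  zero_locus (fun p => exists j : 'I_n, p = (mpoly_intK K (Gform F))^`M(lshift n j)).

Definition VGstar2 (K : fieldType) (n : nat) (F : {mpoly int[n]}) : aff_pt K (n + n) -> Prop :=
  zero_locus (fun p => exists j : 'I_n, p = (mpoly_intK K (Gform F))^`M(rshift n j)).

Arguments VFstar K {n} F _.
Arguments VGstar1 K {n} F _.
Arguments VGstar2 K {n} F _.

(* Main.v *)
Require Import Defs.
From HB Require Import structures.
From mathcomp Require Import all_boot all_order all_algebra.
From mathcomp Require Import boolp reals.
From mathcomp Require Import complex.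
From mathcomp Require Import mpoly ring lra zify.
Set Implicit Arguments.
Unset Strict Implicit.
Unset Printing Implicit Defensive.
Import Order.TTheory GRing.Theory Num.Theory.
Local Open Scope ring_scope.

(* Put z_j = x_j y_j. On V*_{G,1} we have y_j F_j(z) = 0, where F_j is the j-th
   partial derivative of F. Let Z be the top of a chain of length k of
   irreducible closed subsets of V*_{G,1}, and I the set of j with y_j = 0 on Z;
   then F_j(z) = 0 on Z for j outside I.

   A chain of length k makes the functions on Z grow at least like D^k in the
   degree D: if f vanishes on a member of the chain but not on the next one, the
   powers of f times independent functions on the smaller set are independent on
   the larger one. So k is bounded by any upper bound for the growth exponent.
   (1) Z lies in {y_I = 0}, whence k <= 2n - |I|.
   (2) Cutting the cone V*_F by generic linear forms l_1, ..., l_s until only the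
   origin is left yields a chain of length s in V*_F. By the Nullstellensatz,
   K[z] is then finite over K[l_1, ..., l_s, F_1, ..., F_n], and F_j(z) = 0 on Z
   for j outside I. After inverting the y_j with j outside I, all functions on Z
   are generated by x_I, y_{I^c} and z, whence k <= n + s + |I|.
   Adding up, 2k <= 3n + s, which is the claim since s <= dim V*_F. *)

(** * Noetherianity of polynomial rings via Dickson's lemma *)

Section Noetherian.

(** Beyond any [N] there is an index where [u] is minimal among the indices from [N] on; iterating
    this choice gives the subsequence. *)
Lemma nondecreasing_subseq (u : nat -> nat) : exists phi : nat -> nat,
  {homo phi : i j / (i < j)%N} /\ {homo u \o phi : i j / (i <= j)%N}.
Proof.
have /choice[a aP] : forall N, exists i, (N <= i)%N /\
    forall j, (N <= j)%N -> (u i <= u j)%N.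
  move=> N; have ex : exists v, `[< exists2 i, (N <= i)%N & u i = v >].
    by exists (u N); apply/asboolP; exists N.
  case: (ex_minnP ex) => v /asboolP[i Ni uiv] vmin; exists i; split=> // j Nj.
  by rewrite uiv; apply: vmin; apply/asboolP; exists j.
pose phi := fix phi k := if k is k'.+1 then a (phi k').+1 else a 0%N.
exists phi; split.
  by apply: (homo_ltn ltn_trans) => i; case: (aP (phi i).+1).
apply: (homo_leq leqnn leq_trans) => i.
have phiE k : exists2 N, (N <= phi k)%N & phi k = a N.
  case: k => [|k]; [exists 0%N => // | exists (phi k).+1 => //].
  by case: (aP (phi k).+1).
case: (phiE i) => N Nphi phiN; rewrite /= {1}phiN.
case: (aP N) => _; apply; apply: leq_trans Nphi _.
by case: (aP (phi i).+1) => /ltnW.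
Qed.

(** Nondecreasing subsequences are extracted for one coordinate after the other; the first two terms
    of the last subsequence are then comparable. *)
Lemma dickson n (m : nat -> 'X_{1..n}) :
  exists i j, (i < j)%N /\ (m i <= m j)%MM.
Proof.
suff /(_ (enum 'I_n))[phi [phi_lt phi_le]] : forall s : seq 'I_n,
    exists phi : nat -> nat, {homo phi : i j / (i < j)%N} /\
    forall c, c \in s -> {homo (fun i => m (phi i) c) : i j / (i <= j)%N}.
  exists (phi 0%N), (phi 1%N); split; first exact: (phi_lt 0%N 1%N).
  by apply/mnm_lepP => c; apply: (phi_le c _ 0%N 1%N) => //; rewrite mem_enum.
elim=> [|c s [phi [phi_lt phi_le]]]; first by exists id; split=> //.
have [psi [psi_lt psi_le]] := nondecreasing_subseq (fun i => m (phi i) c).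
exists (phi \o psi); split=> [i j ij|c']; first by apply/phi_lt/psi_lt.
rewrite inE => /predU1P[->|c's] //.
by move=> i j ij; apply: (phi_le _ c's); apply: (ltnW_homo psi_lt).
Qed.

Variables (K : fieldType) (n : nat).
Implicit Types (I J : {mpoly K[n]} -> Prop) (p q : {mpoly K[n]}).

Definition is_ideal I :=
  [/\ I 0, forall p q, I p -> I q -> I (p + q) & forall p q, I q -> I (p * q)].

Lemma idealN I p : is_ideal I -> I p -> I (- p).
Proof. by case=> _ _ IM Ip; rewrite -mulN1r; apply: IM. Qed.

Lemma idealB I p q : is_ideal I -> I p -> I q -> I (p - q).
Proof. by move=> idI Ip Iq; case: (idI) => _ + _; apply => //; apply: idealN. Qed.

Lemma ideal_sum I (T : Type) (r : seq T) (P : pred T) (F : T -> {mpoly K[n]}) :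
  is_ideal I -> (forall t, P t -> I (F t)) -> I (\sum_(t <- r | P t) F t).
Proof. by case=> I0 ID _ IF; apply: big_ind. Qed.

(** One step of polynomial division: a scaled monomial times [q] cancels the leading term of [p]. *)
Lemma mlead_reduce p q : p != 0 -> q != 0 -> (mlead q <= mlead p)%MM ->
  exists r, p - r * q = 0 \/ (mlead (p - r * q) < mlead p)%O.
Proof.
move=> p0 q0 qp; pose m := (mlead p - mlead q)%MM.
have mE : (m + mlead q = mlead p)%MM by rewrite submK.
exists ((mleadc p / mleadc q) *: 'X_[m]).
set s := _ * q; have c0 : mleadc p / mleadc q != 0.
  by rewrite mulf_neq0 ?invr_eq0 // mleadc_eq0.
have X0 : (mleadc p / mleadc q) *: 'X_[m] != 0 :> {mpoly K[n]}.
  by rewrite scaler_eq0 (negPf c0) -msize_poly_eq0 msizeX.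
have ls : mlead s = mlead p by rewrite mleadM // mleadZ // mleadXm.
have [->|d0] := eqVneq (p - s) 0; [by left | right].
rewrite lt_neqAle; apply/andP; split; last first.
  by apply: le_trans (mleadB_le _ _) _; rewrite ls joinxx.
apply/eqP => dE; move: d0; rewrite -mleadc_eq0 dE mcoeffB -{2}ls => /eqP; apply.
have -> : mleadc s = mleadc p; last by rewrite subrr.
rewrite mleadcM_proper; first by rewrite mleadcZE mleadXm mcoeffX eqxx mulr1 divfK ?mleadc_eq0.
by rewrite mulf_neq0 // mleadc_eq0.
Qed.

(** Otherwise there is a strictly increasing chain of ideals A_i. Choose f_i in A_(i+1) outside A_i
    with minimal leading monomial. By Dickson's lemma the leading monomial of some f_i divides that
    of a later f_j; reducing f_j by f_i gives an element which minimality puts in A_j, and so f_j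
    itself lies in A_j. *)
Lemma ideal_max (C : ({mpoly K[n]} -> Prop) -> Prop) :
  (forall I, C I -> is_ideal I) -> (exists I, C I) ->
  exists2 I, C I & forall J, C J -> (forall p, I p -> J p) -> forall p, J p -> I p.
Proof.
move=> Cid [I0 CI0]; apply: contrapT => nomax.
have /choice[nxt nxtP] : forall A : {I | C I}, exists B : {I | C I},
    (forall p, sval A p -> sval B p) /\ exists p, sval B p /\ ~ sval A p.
  move=> [I CI]; apply: contrapT => noB; apply: nomax; exists I => // J CJ IJ p Jp.
  by apply: contrapT => nIp; apply: noB; exists (exist _ J CJ); split=> //; exists p.
pose A i : {I | C I} := iter i nxt (exist _ I0 CI0).
have Aid i : is_ideal (sval (A i)) by apply/Cid/(svalP (A i)).
have Amon i j p : (i <= j)%N -> sval (A i) p -> sval (A j) p.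
  move=> /subnK <-; elim: (j - i)%N => //= k IH /IH.
  by case: (nxtP (A (k + i)%N)) => + _; apply.
have /choice[f fP] : forall i, exists p, [/\ sval (A i.+1) p, ~ sval (A i) p &
    forall q, sval (A i.+1) q -> (mlead q < mlead p)%O -> sval (A i) q].
  move=> i; apply: contrapT => nop.
  suff H : forall p, sval (A i.+1) p -> sval (A i) p.
    by case: (nxtP (A i)) => _ [p [/H]].
  elim/mleadrect => p IH Ap; apply: contrapT => nAp; apply: nop.
  by exists p; split=> // q Aq /IH; apply.
have [i [j [ij mij]]] := dickson (fun i => mlead (f i)).
have f0 k : f k != 0.
  by apply/eqP => fk; case: (fP k); rewrite fk => _; case: (Aid k).
have [r rP] := mlead_reduce (f0 j) (f0 i) mij.
have [fj nfj fmin] := fP j; have [fi _ _] := fP i.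
have Arf : sval (A j) (r * f i).
  by case: (Aid j) => _ _; apply; apply: Amon fi.
apply: nfj; rewrite -(subrK (r * f i) (f j)).
case: (Aid j) => A0 AD _; apply: AD => //.
case: rP => [->//|]; apply: fmin; apply: idealB => //; exact: (Amon j).
Qed.

End Noetherian.

(** * Uncountability of the real and complex numbers *)

Section Uncountable.

(* The form in which uncountability of the ground field is used. *)
Definition large_fibre (T : eqType) := forall f : T -> nat,
  exists D, forall k, exists s : seq T,
    [/\ uniq s, forall a, a \in s -> f a = D & size s = k].

(** If no list exhausts [P], fresh elements can be added one at a time until the list has length
    [k]. *)
Lemma finite_enum (T : choiceType) (P : T -> Prop) (k : nat) :
  (forall s : seq T, uniq s -> (forall a, a \in s -> P a) -> size s <> k) ->
  exists s : seq T, forall a, P a -> a \in s.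
Proof.
move=> nok; apply: contrapT => nos.
suff [s [us Ps]] : exists s : seq T, [/\ uniq s, forall a, a \in s -> P a & size s = k].
  exact: nok us Ps.
elim: k {nok} => [|k [s [us Ps sk]]]; first by exists [::].
have [a [Pa nas]] : exists a, P a /\ a \notin s.
  apply: contrapT => noa; apply: nos; exists s => a Pa.
  by apply/negPn/negP => nas; apply: noa; exists a.
exists (a :: s); split=> /=; [by rewrite nas | | by rewrite sk].
by move=> b; rewrite inE => /predU1P[->|/Ps].
Qed.

Variable R : realType.

(** For each point of [s] the interval is replaced by one of its outer thirds, chosen to miss that
    point. *)
Lemma avoid_seq (s : seq R) (a b : R) : a < b ->
  exists u : R * R, [/\ a <= u.1, u.1 < u.2, u.2 <= b &
    forall x, x \in s -> ~~ (u.1 <= x <= u.2)].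
Proof.
elim: s a b => [|x s IH] a b ab; first by exists (a, b); split.
pose c := a + (b - a) / 3; pose d := a + 2 * ((b - a) / 3).
have [ac cd db] : [/\ a < c, c < d & d < b] by rewrite /c /d; split; lra.
have [xc|xc] := leP x c.
  have [u [du u12 ub us]] := IH d b db; exists u; split=> //.
    by apply: le_trans du; apply/ltW/(lt_trans ac).
  move=> y; rewrite inE => /predU1P[->|/us //].
  by rewrite negb_and -ltNge (le_lt_trans xc) // (lt_le_trans cd).
have [u [du u12 ub us]] := IH a c ac; exists u; split=> //.
  by apply: le_trans ub _; apply/ltW/(lt_trans cd).
move=> y; rewrite inE => /predU1P[->|/us //].
by rewrite negb_and orbC -ltNge (le_lt_trans ub).
Qed.

(** Otherwise every fibre [D] is contained in a finite list [L D]. Take nested intervals, the one at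
    stage [D.+1] avoiding [L D]. The supremum of the left ends lies in all of them, hence outside
    the list of its own fibre. *)
Lemma uncountable_real : large_fibre R.
Proof.
move=> f; apply: contrapT => noD.
have /choice[L LP] : forall D, exists s : seq R, forall a, f a = D -> a \in s.
  move=> D; apply: contrapT => nos; apply: noD; exists D => k.
  apply: contrapT => nok; apply: nos; apply: (@finite_enum _ _ k) => s us sD sk.
  by apply: nok; exists s.
have /choice[nxt nxtP] : forall x : nat * (R * R), exists u : R * R,
    x.2.1 < x.2.2 -> [/\ x.2.1 <= u.1, u.1 < u.2, u.2 <= x.2.2 &
    forall y, y \in L x.1 -> ~~ (u.1 <= y <= u.2)].
  move=> [D [a b]] /=; have [ab|ab] := ltP a b; last by exists (a, b).
  by have [u] := avoid_seq (L D) ab; exists u.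
pose U := fix U i := if i is i'.+1 then nxt (i', U i') else (0, 1) : R * R.
have U12 i : (U i).1 < (U i).2.
  by elim: i => [|i IH] /=; [exact: ltr01 | case: (nxtP (i, U i) IH)].
have Um i j : (i <= j)%N -> (U i).1 <= (U j).1 /\ (U j).2 <= (U i).2.
  move=> /subnK <-; elim: (j - i)%N => //= k [IH1 IH2].
  case: (nxtP ((k + i)%N, U (k + i)%N) (U12 _)) => /= a1 _ a2 _.
  by split; [exact: le_trans a1 | exact: le_trans IH2].
have Ult i j : (U i).1 <= (U j).2.
  have [_ m1] := Um _ _ (leq_maxr i j); have [m2 _] := Um _ _ (leq_maxl i j).
  by apply: le_trans m2 _; apply: le_trans m1; apply: ltW.
pose A : R -> Prop := fun x => exists i, x = (U i).1.
have c1 i : (U i).1 <= sup A.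
  by apply: ub_le_sup; [exists (U 0%N).2 => _ [j ->] | exists i].
have c2 i : sup A <= (U i).2.
  by apply: ge_sup; [exists (U 0%N).1; exists 0%N | move=> _ [j ->]].
case: (nxtP (f (sup A), U (f (sup A))) (U12 _)) => _ _ _ /(_ _ (LP _ _ erefl)).
by rewrite (c1 (f (sup A)).+1) (c2 (f (sup A)).+1).
Qed.

Lemma uncountable_complex : large_fibre R[i].
Proof.
move=> f; have [D DP] := uncountable_real (fun x => f x%:C%C); exists D => k.
have [s [us sD sk]] := DP k; exists (map (fun x => x%:C%C) s); split.
- by rewrite map_inj_uniq // => x y [].
- by move=> _ /mapP[x xs ->]; apply: sD.
- by rewrite size_map.
Qed.

End Uncountable.

Lemma linear_dependence (K : fieldType) (T U : finType) (A : T -> U -> K) :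
  (#|U| < #|T|)%N ->
  exists c : T -> K, (exists t, c t != 0) /\ forall u, \sum_t c t * A t u = 0.
Proof.
move=> UT; pose M := \matrix_(i < #|T|, j < #|U|) A (enum_val i) (enum_val j).
have /rowV0Pn[v /sub_kermxP vM v0] : kermx M != 0.
  by rewrite kermx_eq0 /row_free neq_ltn (leq_ltn_trans (rank_leq_col M)).
exists (fun t => v ord0 (enum_rank t)); split.
  have /rV0Pn[i vi] := v0; exists (enum_val i); by rewrite enum_valK.
move=> u; have /rowP/(_ (enum_rank u)) := vM; rewrite !mxE => sum0.
rewrite -[RHS]sum0 (reindex_onto enum_val enum_rank) /=; last first.
  by move=> t _; rewrite enum_rankK.
apply: eq_big => [i|i _]; first by rewrite enum_valK eqxx.
by rewrite !mxE enum_valK enum_rankK.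
Qed.

(** * Nullstellensatz over an uncountable algebraically closed field *)

Section Nullstellensatz.

Variables (K : closedFieldType) (n : nat).
Hypothesis uncountable : large_fibre K.
Variables (T : finType) (g : T -> {mpoly K[n]}) (h : {mpoly K[n]}).
Implicit Types (p q r : {mpoly K[n]}).

(** These ideals contain all [g t] and stay proper after inverting [h]. Avoiding the powers of [h]
    takes the place of Rabinowitsch's extra variable. *)
Let avoids (M : {mpoly K[n]} -> Prop) :=
  [/\ is_ideal M, forall t, M (g t) & forall N, ~ M (h ^+ N)].

Variable M : {mpoly K[n]} -> Prop.
Hypotheses (avM : avoids M) (maxM : forall J, avoids J ->
  (forall p, M p -> J p) -> forall p, J p -> M p).

Let idM : is_ideal M. Proof. by case: avM. Qed.

(** The ideal generated by [M] and [p] is strictly larger than [M], so by maximality it contains a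
    power of [h]. *)
Lemma unit_mod_max p : ~ M p -> exists N r, M (h ^+ N - r * p).
Proof.
move=> nMp; apply: contrapT => noN; apply: nMp.
have [M0 MD MM] := idM; have [_ Mg _] := avM.
pose J q := exists r, M (q - r * p).
apply: (maxM (J := J)); last by exists 1; rewrite mul1r subrr.
- split; last by move=> N [r Mr]; apply: noN; exists N, r.
    split; first by exists 0; rewrite mul0r subr0.
      move=> q1 q2 [r1 Mr1] [r2 Mr2]; exists (r1 + r2).
      by rewrite mulrDl opprD addrACA; apply: (MD).
    move=> q1 q2 [r2 Mr2]; exists (q1 * r2).
    by rewrite -mulrA -mulrBr; apply: (MM).
  by move=> t; exists 0; rewrite mul0r subr0.
- by move=> q Mq; exists 0; rewrite mul0r subr0.
Qed.

Lemma max_prime p q : M (p * q) -> M p \/ M q.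
Proof.
have [M0 MD MM] := idM; have [_ _ Mh] := avM.
move=> Mpq; apply: contrapT => /not_orP[/unit_mod_max[N [r Mr]] nMq].
have [N' [r' Mr']] := unit_mod_max nMq; apply: (Mh (N + N')%N); rewrite exprD.
have -> : h ^+ N * h ^+ N' = h ^+ N' * (h ^+ N - r * p)
    + r * p * (h ^+ N' - r' * q) + r * r' * (p * q).
  by rewrite !mulrBr (mulrC (h ^+ N')) [r * p * (r' * q)]mulrACA
    (mulrC (h ^+ N')) addrA subrK subrK.
by apply: (MD); [apply: (MD)|]; apply: (MM).
Qed.

Lemma max_const c : M c%:MP -> c = 0.
Proof.
have [_ _ MM] := idM; have [_ _ Mh] := avM => Mc; apply/eqP/negPn/negP => c0.
by apply: (Mh 0%N); rewrite expr0 -mpolyC1 -(mulVf c0) mpolyCM; apply: (MM).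
Qed.

(** [Q] splits into linear factors, and [M] is prime and contains no nonzero constant. *)
Lemma max_root (Q : {poly K}) j : Q != 0 ->
  M (map_poly (@mpolyC n K) Q).['X_j] -> exists a, M ('X_j - a%:MP).
Proof.
have [_ _ MM] := idM; have [_ _ Mh] := avM.
have [s ->] := closed_field_poly_normal Q => Q0.
have c0 : lead_coef Q != 0.
  by apply: contraNneq Q0 => ->; rewrite scale0r.
rewrite map_polyZ hornerZ => /max_prime[/max_const/eqP|]; first by rewrite (negPf c0).
elim: s {Q0} => [|a s IH].
  by rewrite big_nil rmorph1 hornerC => M1; case: (Mh 0%N); rewrite expr0.
rewrite big_cons rmorphM hornerM => /max_prime[|/IH //].
by rewrite rmorphB /= map_polyX map_polyC hornerXsubC; exists a.
Qed.

(* If no [X_j - a] were in [M], each would be invertible modulo [M] up to a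
   power of [h]; uncountably many inverses of the same bounded degree are
   linearly dependent, which yields a nonzero polynomial in [X_j] inside [M]. *)
Lemma max_coord j : exists a, M ('X_j - a%:MP).
Proof.
have [M0 MD MM] := idM; have [_ _ Mh] := avM.
apply: contrapT => noa.
have /choice[w wP] : forall a, exists w : nat * {mpoly K[n]},
    M (h ^+ w.1 - w.2 * ('X_j - a%:MP)).
  move=> a; have /unit_mod_max[N [r Mr]] : ~ M ('X_j - a%:MP).
    by move=> Ma; apply: noa; exists a.
  by exists (N, r).
(* The fibre map codes the pair (exponent of [h], size of the inverse). One pair ([N], [D]) is
   shared by more values [a] than there are monomials of degree below [D], which forces a linear
   relation between the inverses. *)
have [c0 /(_ #|{: 'X_{1..n < (odflt (0, 0)%N (unpickle c0)).2}}|.+1)[s [us sc sz]]] :=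
  uncountable (fun a => pickle ((w a).1, msize (w a).2)).
set N := (odflt (0, 0)%N (unpickle c0)).1; set D := (odflt _ _).2 in sz.
have sE a : a \in s -> (w a).1 = N /\ msize (w a).2 = D.
  by move=> /sc E; rewrite /N /D -E pickleK.
pose a (i : 'I_(size s)) := tnth (in_tuple s) i.
have as_ i : a i \in s by rewrite mem_tnth.
have ainj : injective a.
  by move=> i i' /eqP; rewrite /a !(tnth_nth 0) /= nth_uniq // => /eqP/val_inj.
have [c [[i0 ci0] csum]] := @linear_dependence K 'I_(size s) 'X_{1..n < D}
  (fun i m => (w (a i)).2@_m) ltac:(by rewrite card_ord sz).
have sum0 : \sum_i c i *: (w (a i)).2 = 0.
  apply/mpolyP => m; rewrite mcoeff0 raddf_sum /=.
  under eq_bigr => i _ do rewrite mcoeffZ.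
  have [mD|mD] := ltnP (mdeg m) D; first exact: (csum (BMultinom mD)).
  rewrite big1 // => i _; rewrite memN_msupp_eq0 ?mulr0 //.
  by apply: msize_mdeg_ge; case: (sE (a i)) => // _ ->.
(* This is the numerator of the sum of the fractions c_i / (X - a_i). At a_(i0) it equals c_(i0)
   times a product of nonzero differences. *)
pose Q : {poly K} := \sum_i c i *: \prod_(i' | i' != i) ('X - (a i')%:P).
have Q0 : Q != 0.
  apply: contraNneq ci0 => /(congr1 (horner^~ (a i0))).
  rewrite horner0 /Q horner_sum (bigD1 i0) //= [X in _ + X]big1 ?addr0 => [|i ii0].
    rewrite hornerZ horner_prod => /eqP; rewrite mulf_eq0 => /orP[//|].
    rewrite prodf_seq_eq0 => /hasP[i' _ /andP[i'0]].
    by rewrite hornerXsubC subr_eq0 (inj_eq ainj) eq_sym (negPf i'0).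
  by rewrite hornerZ (bigD1 i0) 1?eq_sym //= hornerM hornerXsubC subrr mul0r mulr0.
apply: noa; apply: (max_root Q0).
suff /max_prime[/Mh//|//] : M (h ^+ N * (map_poly (@mpolyC n K) Q).['X_j]).
pose P i := \prod_(i' | i' != i) ('X_j - (a i')%:MP) : {mpoly K[n]}.
have -> : (map_poly (@mpolyC n K) Q).['X_j] = \sum_i (c i)%:MP * P i.
  rewrite /Q rmorph_sum horner_sum; apply: eq_bigr => i _.
  rewrite /= map_polyZ hornerZ rmorph_prod horner_prod; congr (_ * _).
  by apply: eq_bigr => i' _; rewrite rmorphB /= map_polyX map_polyC hornerXsubC.
(* The subtracted terms add up to the relation [sum0] times the product of all X_j - a_i, hence to
   0, while each summand on the right lies in [M]. *)
have -> : h ^+ N * (\sum_i (c i)%:MP * P i) =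
    \sum_i (c i)%:MP * P i * (h ^+ N - (w (a i)).2 * ('X_j - (a i)%:MP)).
  rewrite mulrC mulr_suml -[LHS]subr0; under [RHS]eq_bigr do rewrite mulrBr.
  rewrite sumrB; congr (_ - _).
  transitivity ((\sum_i c i *: (w (a i)).2) * \prod_i ('X_j - (a i)%:MP)).
    by rewrite sum0 mul0r.
  rewrite mulr_suml; apply: eq_bigr => i _.
  by rewrite (bigD1 i) //= -/(P i) -mul_mpolyC; ring.
apply: ideal_sum => // i _; apply: (MM).
by case: (sE (a i)) => // <- _; apply: wP.
Qed.

(** Since [M] contains X_j - x_j for every j, each polynomial is congruent to its value at x modulo
    [M]; a nonzero value of [g t], or a zero value of [h], would contradict the choice of [M]. *)
Lemma max_point : exists2 x : aff_pt K n, (forall t, (g t).@[x] = 0) & h.@[x] != 0.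
Proof.
have [M0 MD MM] := idM; have [_ Mg Mh] := avM.
have /choice[x xP] := max_coord.
have Mev p : M (p - p.@[x]%:MP).
  elim/mpolyind: p => [|c m p _ _ IH]; first by rewrite meval0 subr0.
  rewrite mevalD mpolyCD opprD addrACA; apply: (MD) => //.
  rewrite mevalZ mpolyCM mul_mpolyC -scalerBr -mul_mpolyC; apply: (MM).
  rewrite mevalX mpolyXE_id; elim/big_rec2: _ => [|i y1 y2 _ IHy]; first by rewrite subrr.
  have -> : 'X_i ^+ m i * y2 - (x i ^+ m i * y1)%:MP =
     (y2 * ('X_i ^+ m i - (x i)%:MP ^+ m i)) + ((x i)%:MP ^+ m i) * (y2 - y1%:MP).
    rewrite mpolyCM rmorphXn /= !mulrBr addrA (mulrC y2) (mulrC y2) subrK //.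
  by apply: (MD); apply: (MM) => //; rewrite subrXX mulrC; apply: (MM).
exists x => [t|].
  by apply: max_const; rewrite -[_%:MP](subKr (g t)); apply: idealB.
apply/eqP => hx; apply: (Mh 1%N); rewrite expr1.
by move: (Mev h); rewrite hx subr0.
Qed.

End Nullstellensatz.

(** If no power of [h] lies in the ideal of the [g t], that ideal extends to a maximal one avoiding
    these powers, and [max_point] produces a common zero of the [g t] where [h] is nonzero. *)
Theorem nullstellensatz (K : closedFieldType) (n : nat)
    (uncountable : large_fibre K)
    (T : finType) (g : T -> {mpoly K[n]}) (h : {mpoly K[n]}) :
  (forall x : aff_pt K n, (forall t, (g t).@[x] = 0) -> h.@[x] = 0) ->
  exists N (q : T -> {mpoly K[n]}), h ^+ N = \sum_t q t * g t.
Proof.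
move=> hV; apply: contrapT => noN.
pose J p := exists q : T -> {mpoly K[n]}, p = \sum_t q t * g t.
pose avoids (M : {mpoly K[n]} -> Prop) :=
  [/\ is_ideal M, forall t, M (g t) & forall N, ~ M (h ^+ N)].
have avJ : avoids J.
  split; [split| |].
  - by exists (fun=> 0); rewrite big1 // => t _; rewrite mul0r.
  - move=> _ _ [q1 ->] [q2 ->]; exists (fun t => q1 t + q2 t).
    by rewrite -big_split; apply: eq_bigr => t _; rewrite mulrDl.
  - move=> p _ [q ->]; exists (fun t => p * q t).
    by rewrite mulr_sumr; apply: eq_bigr => t _; rewrite mulrA.
  - move=> t; exists (fun t' => (t' == t)%:R).
    rewrite (bigD1 t) //= eqxx mul1r big1 ?addr0 // => t' /negPf ->.
    by rewrite mul0r.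
  - by move=> N [q E]; apply: noN; exists N, q.
have [M avM maxM] := @ideal_max K n avoids (fun I => ltac:(by case)) (ex_intro _ J avJ).
have [x gx] := max_point uncountable avM maxM.
by rewrite hV // eqxx.
Qed.

(** * Zariski closed sets, irreducibility and decomposition *)

Section Zariski.

Variables (K : fieldType) (m : nat).
Implicit Types (V W Z : aff_pt K m -> Prop) (p q : {mpoly K[m]}).

Definition vanishing V p := forall x, V x -> p.@[x] = 0.

Lemma vanishing_ideal V : is_ideal (vanishing V).
Proof.
split=> [x _|p q Vp Vq x Vx|p q Vq x Vx]; first exact: meval0.
  by rewrite mevalD Vp ?Vq ?addr0.
by rewrite mevalM Vq ?mulr0.
Qed.

Lemma zclosedP V x : zclosed V -> (forall p, vanishing V p -> p.@[x] = 0) -> V x.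
Proof.
by case=> S VS Ix; apply/VS => p Sp; apply: Ix => y /VS; apply.
Qed.

Lemma zclosed_neg V x : zclosed V -> ~ V x -> exists2 p, vanishing V p & p.@[x] != 0.
Proof.
move=> cV nVx; apply: contrapT => nop; apply: nVx; apply: zclosedP => // p Vp.
by apply/eqP/negPn/negP => px; apply: nop; exists p.
Qed.

Lemma zclosed_root p : zclosed (fun x : aff_pt K m => p.@[x] = 0).
Proof. by exists (eq p) => x; split=> [px _ <-//|]; apply. Qed.

Lemma zclosedI V W : zclosed V -> zclosed W -> zclosed (fun x => V x /\ W x).
Proof.
move=> [S VS] [S' WS]; exists (fun p => S p \/ S' p) => x; split.
  by move=> [/VS Sx /WS S'x] p [/Sx|/S'x].
by move=> xS; split; [apply/VS|apply/WS] => p Sp; apply: xS; [left|right].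
Qed.

Lemma zclosedU V W : zclosed V -> zclosed W -> zclosed (fun x => V x \/ W x).
Proof.
move=> cV cW; exists (vanishing (fun x => V x \/ W x)) => x; split=> [VWx p|xS].
  by apply.
apply: contrapT => /not_orP[/(zclosed_neg cV)[p Vp px] /(zclosed_neg cW)[q Wq qx]].
have /xS/eqP : vanishing (fun x => V x \/ W x) (p * q).
  by move=> y [/Vp|/Wq] E; rewrite mevalM E ?mul0r ?mulr0.
by rewrite mevalM mulf_eq0 (negPf px) (negPf qx).
Qed.

(** Noetherian induction: among the closed counterexamples, one with maximal vanishing ideal has no
    smaller counterexample inside it. *)
Lemma zclosed_ind (P : (aff_pt K m -> Prop) -> Prop) :
  (forall V, zclosed V -> (forall W, zclosed W -> aff_subset W V ->
     (exists x, V x /\ ~ W x) -> P W) -> P V) ->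
  forall V, zclosed V -> P V.
Proof.
move=> step V0 cV0; apply: contrapT => nPV0.
pose C (I : {mpoly K[m]} -> Prop) := exists V, [/\ zclosed V, ~ P V & I = vanishing V].
have Cid I : C I -> is_ideal I by case=> V [_ _ ->]; apply: vanishing_ideal.
have CV0 : exists I, C I by exists (vanishing V0), V0.
have [_ [V [cV nPV ->]] maxV] := ideal_max Cid CV0.
apply: nPV; apply: step => // W cW WV [x [Vx nWx]]; apply: contrapT => nPW.
have [p Wp /eqP] := zclosed_neg cW nWx; apply.
apply: (maxV (vanishing W)) => //; first by exists W.
by move=> q Vq y /WV; apply: Vq.
Qed.

Lemma zirr_closed Z : zirreducible Z -> zclosed Z. Proof. by case. Qed.

Lemma zirr_prime Z p q : zirreducible Z ->
  vanishing Z (p * q) -> vanishing Z p \/ vanishing Z q.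
Proof.
case=> _ _ /(_ _ _ (zclosed_root p) (zclosed_root q)) irr pq; apply: irr => x Zx.
by have /eqP := pq x Zx; rewrite mevalM mulf_eq0 => /orP[]/eqP; [left|right].
Qed.

Lemma zirr_expr Z p k : zirreducible Z -> vanishing Z (p ^+ k) -> vanishing Z p.
Proof.
move=> irrZ; elim: k => [|k IH].
  by case: irrZ => _ [x Zx] _ /(_ x Zx)/eqP; rewrite expr0 meval1 oner_eq0.
by rewrite exprS => /(zirr_prime irrZ)[|/IH].
Qed.

Lemma zirr_bigU Z (r : nat) (W : nat -> aff_pt K m -> Prop) :
  zirreducible Z -> (forall i, (i < r)%N -> zclosed (W i)) ->
  (forall x, Z x -> exists2 i, (i < r)%N & W i x) ->
  exists2 i, (i < r)%N & aff_subset Z (W i).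
Proof.
have bigU k : (forall i, (i < k)%N -> zclosed (W i)) ->
    zclosed (fun x => exists2 i, (i < k)%N & W i x).
  elim: k => [|k IH] cW.
    (* The empty union is the common zero locus of all polynomials, the constant 1 among them. *)
    by exists (fun=> True) => x; split=> [[]//|/(_ 1 I)/eqP]; rewrite meval1 oner_eq0.
  have [|S SP] := zclosedU (IH _) (cW k (ltnSn k)).
    by move=> i ik; apply: cW; apply: ltnW.
  exists S => x; rewrite -SP; split.
    by case=> i; rewrite ltnS leq_eqVlt => /predU1P[->|ik] Wix; [right|left; exists i].
  by case=> [[i ik Wix]|Wkx]; [exists i => //; apply: ltnW|exists k].
move=> irrZ; elim: r => [|k IH] cW ZW.
  by case: irrZ => _ [x /ZW[]].
have cW' i : (i < k)%N -> zclosed (W i) by move=> /ltnW; apply: cW.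
case: (irrZ) => _ _ /(_ _ _ (bigU k cW') (cW k (ltnSn k)))[x /ZW|ZU|Zk].
- case=> i; rewrite ltnS leq_eqVlt => /predU1P[->|ik] Wix; [by right|].
  by left; exists i.
- by have [i ik Zi] := IH cW' ZU; exists i => //; apply: ltnW.
- by exists k.
Qed.

(** Noetherian induction: a nonempty reducible set is the union of two proper closed subsets. The
    pieces may be redundant; later arguments use only that they cover [V]. *)
Lemma zirr_decomposition V : zclosed V ->
  exists r (Z : nat -> aff_pt K m -> Prop),
    (forall i, (i < r)%N -> zirreducible (Z i) /\ aff_subset (Z i) V) /\
    (forall x, V x -> exists2 i, (i < r)%N & Z i x).
Proof.
move: V; apply: zclosed_ind => V cV IH.
have [[x0 Vx0]|V0] := pselect (exists x, V x); last first.
  by exists 0%N, (fun=> V); split=> // x Vx; case: V0; exists x.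
have [irrV|nirrV] := pselect (zirreducible V).
  by exists 1%N, (fun=> V); split=> [i _|x Vx]; [split|exists 0%N].
have [Z1 [Z2 [cZ1 cZ2 VZ nVZ1 nVZ2]]] : exists Z1 Z2 : aff_pt K m -> Prop,
    [/\ zclosed Z1, zclosed Z2, forall x, V x -> Z1 x \/ Z2 x,
        ~ aff_subset V Z1 & ~ aff_subset V Z2].
  apply: contrapT => noZ; apply: nirrV; split=> //; first by exists x0.
  move=> Z1 Z2 cZ1 cZ2 VZ; apply: contrapT => /not_orP[V1 V2].
  by apply: noZ; exists Z1, Z2.
have IHZ Z : zclosed Z -> ~ aff_subset V Z ->
    exists r (Y : nat -> aff_pt K m -> Prop),
    (forall i, (i < r)%N -> zirreducible (Y i) /\ aff_subset (Y i) V) /\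
    (forall x, V x -> Z x -> exists2 i, (i < r)%N & Y i x).
  move=> cZ nVZ; have [||r [Y [Yirr Ycov]]] := IH _ (zclosedI cV cZ).
  - by move=> x [].
  - apply: contrapT => nox; apply: nVZ => x Vx; apply: contrapT => nZx.
    by apply: nox; exists x; split=> // -[].
  exists r, Y; split=> [i /Yirr[? YV]|x Vx Zx]; last exact: Ycov.
  by split=> // x /YV[].
have [r1 [Y1 [irr1 cov1]]] := IHZ _ cZ1 nVZ1.
have [r2 [Y2 [irr2 cov2]]] := IHZ _ cZ2 nVZ2.
exists (r1 + r2)%N, (fun i => if (i < r1)%N then Y1 i else Y2 (i - r1)%N).
split=> [i ir|x Vx].
  by case: ltnP => ir1; [apply: irr1 | apply: irr2; lia].
have [Z1x|Z2x] := VZ x Vx.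
  by have [i ir Yi] := cov1 x Vx Z1x; exists i; rewrite ?ir //; lia.
have [i ir Yi] := cov2 x Vx Z2x; exists (r1 + i)%N; first lia.
by rewrite ltnNge leq_addr addKn.
Qed.

End Zariski.

(** * Cutting cones by generic linear forms *)

Section Cones.

Variables (K : closedFieldType) (m : nat).
Implicit Types (V W Z : aff_pt K m -> Prop) (p q : {mpoly K[m]}).

Lemma dhomog_meval d p (t : K) (x : aff_pt K m) : p \is d.-homog ->
  p.@[fun i => t * x i] = t ^+ d * p.@[x].
Proof.
move=> /dhomogP hp; rewrite !mevalE mulr_sumr big_seq [RHS]big_seq.
apply: eq_bigr => u /hp ud; rewrite mulrCA; congr (_ * _).
under eq_bigr do rewrite exprMn.
by rewrite big_split /= -expr_sum -mdegE ud.
Qed.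

Lemma line_poly p (x : aff_pt K m) :
  exists q : {poly K}, forall t, q.[t] = p.@[fun j => t * x j].
Proof.
elim/mpolyind: p => [|c u p _ _ [q qP]]; first by exists 0 => t; rewrite horner0 meval0.
exists (c *: \prod_j (x j *: 'X) ^+ u j + q) => t.
rewrite hornerD hornerZ horner_prod qP mevalD mevalZ mevalX; congr (_ * _ + _).
by apply: eq_bigr => j _; rewrite horner_exp hornerZ hornerX mulrC.
Qed.

(** Each piece missing the origin has an equation nonzero there, whose restriction to the line
    through [x] is a nonzero polynomial in [t]. The product of these is [q], so for generic [t] the
    point [t x] lies only on pieces through the origin. *)
Lemma line_meets (x : aff_pt K m) (r : nat) (Z : nat -> aff_pt K m -> Prop) :
  (forall i, (i < r)%N -> zclosed (Z i)) ->
  exists2 q : {poly K}, q != 0 & forall t, q.[t] != 0 ->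
    forall i, (i < r)%N -> Z i (fun j => t * x j) -> Z i (fun=> 0).
Proof.
elim: r => [|r IH] cZ; first by exists 1; rewrite ?oner_eq0.
have [i /ltnW|q q0 qP] := IH; first exact: cZ.
have [Zr0|nZr0] := pselect (Z r (fun=> 0)).
  exists q => // t qt i; rewrite ltnS leq_eqVlt => /predU1P[->//|].
  exact: qP.
have [p Zp p0] := zclosed_neg (cZ r (ltnSn r)) nZr0.
have [q' q'P] := line_poly p x.
have q'0 : q' != 0.
  apply: contraNneq p0 => q'0; suff <- : q'.[0] = p.@[fun=> 0] by rewrite q'0 horner0.
  by rewrite q'P; apply: meval_eq => j; rewrite mul0r.
exists (q * q'); first by rewrite mulf_neq0.
move=> t; rewrite hornerM mulf_eq0 negb_or => /andP[qt q't] i.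
rewrite ltnS leq_eqVlt => /predU1P[->|]; last exact: qP.
by move/Zp/eqP; rewrite -q'P (negPf q't).
Qed.

(** The form has coefficients t^j on the moment curve: its value at [x i] is a polynomial in [t],
    nonzero when [x i] is, and some [t] avoids all the roots. *)
Lemma generic_linear_form (r : nat) (x : nat -> aff_pt K m) :
  exists2 l : {mpoly K[m]}, l \is 1.-homog & forall i j, (i < r)%N ->
    x i j != 0 -> l.@[x i] != 0.
Proof.
pose Q i : {poly K} := \sum_j (x i j) *: 'X^j.
have Q0 i j : x i j != 0 -> Q i != 0.
  apply: contraNneq => /(congr1 (fun q : {poly K} => q`_j)).
  rewrite coef0 coef_sum (bigD1 j) //= coefZ coefXn eqxx mulr1 big1 ?addr0 => [->//|].
  by move=> j' /negPf jj'; rewrite coefZ coefXn eq_sym (inj_eq val_inj) jj' mulr0.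
have /closed_nonrootP[t] : \prod_(i < r | Q i != 0) Q i != 0.
  by apply/prodf_neq0.
rewrite /root horner_prod prodf_seq_eq0 -all_predC => /allP tQ.
exists (\sum_(j < m) t ^+ j *: 'X_j).
  by apply: rpred_sum => j _; apply: rpredZ; rewrite dhomogX /= mdeg1.
move=> i j ir xij; have /= := tQ (Ordinal ir) (mem_index_enum _).
rewrite (Q0 _ _ xij) /= raddf_sum /= horner_sum.
suff -> : \sum_(i0 < m) (t ^+ i0 *: 'X_i0).@[x i] = \sum_(i0 < m) (x i i0 *: 'X^i0).[t] by [].
by apply: eq_bigr => k _; rewrite mevalZ mevalXU hornerZ hornerXn mulrC.
Qed.

Lemma zirr_point (x : aff_pt K m) : zirreducible (fun y => y = x).
Proof.
split; [|by exists x|].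
- exists (fun p => exists j, p = 'X_j - (x j)%:MP) => y; split.
    by move=> -> _ [j ->]; rewrite mevalB mevalXU mevalC subrr.
  move=> yS; apply/funext => j; apply/eqP; rewrite -subr_eq0.
  have := yS ('X_j - (x j)%:MP) (ex_intro _ j erefl).
  by rewrite mevalB mevalXU mevalC => ->.
- by move=> Z1 Z2 _ _ /(_ x erefl)[Zx|Zx]; [left|right] => y ->.
Qed.

Lemma cone_cut V : zclosed V -> V (fun=> 0) ->
  (forall (t : K) x, V x -> V (fun j => t * x j)) ->
  exists ls : seq {mpoly K[m]}, [/\ forall l, l \in ls -> l \is 1.-homog,
    irr_chain V (size ls) &
    forall x, V x -> (forall l, l \in ls -> l.@[x] = 0) -> x = (fun=> 0)].
Proof.
move: V; apply: zclosed_ind => V cV IH V0 Vcone.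
have [[x0 [Vx0 x0N]]|V0'] := pselect (exists x, V x /\ x <> (fun=> 0)); last first.
  exists [::]; split=> //; last first.
    by move=> x Vx _; apply: contrapT => x0; apply: V0'; exists x.
  exists (fun=> (fun y => y = (fun=> 0))); split=> // i _.
  by split; [exact: zirr_point | move=> x ->].
have x0j (x : aff_pt K m) : x <> (fun=> 0) -> exists j, x j != 0.
  move=> xN; apply: contrapT => noj; apply: xN; apply/funext => j.
  by apply/eqP/negPn/negP => xj; apply: noj; exists j.
have [r [Z [Zirr Zcov]]] := zirr_decomposition cV.
(* A piece contained in the origin gets the dummy point 0, where nothing is asked of the linear
   form. *)
have /choice[pt ptP] : forall i, exists x : aff_pt K m,
    (exists2 y, Z i y & y <> (fun=> 0)) -> Z i x /\ x <> (fun=> 0).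
  move=> i; have [[y Zy yN]|no] := pselect (exists2 y, Z i y & y <> (fun=> 0)).
    by exists y.
  by exists (fun=> 0) => /no.
have [l l1 lP] := generic_linear_form r pt.
have lpt i : (i < r)%N -> (exists2 y, Z i y & y <> (fun=> 0)) -> l.@[pt i] != 0.
  by move=> ir /ptP[_ /x0j[j]]; apply: lP.
pose W x := V x /\ l.@[x] = 0.
have [||||ls [ls1 lsW lsN]] := IH W (zclosedI cV (zclosed_root l)).
- by move=> x [].
- have [i ir Zx0] := Zcov _ Vx0.
  have ex : exists2 y, Z i y & y <> (fun=> 0) by exists x0.
  exists (pt i); split; last by case=> _ /eqP; apply/negP/lpt.
  by have [_] := Zirr i ir; apply; case: (ptP i ex).
- by split=> //; rewrite -[X in _ = X](mul0r l.@[fun=> 0]) -[X in X * _](expr1 0)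
    -(dhomog_meval 0 _ l1); apply: meval_eq => j; rewrite mul0r.
- move=> t x [Vx lx]; split; first exact: Vcone.
  by rewrite (dhomog_meval _ _ l1) lx mulr0.
exists (l :: ls); split.
- by move=> l'; rewrite inE => /predU1P[->|/ls1].
- have [Y [Yirr Ylt]] := lsW; set k := size ls in Yirr Ylt *.
  have [irrT TW] := Yirr k (leqnn k).
  (* Such a piece extends the chain strictly: its point [pt i] is off the hyperplane, while the top
     [Y k] lies in it. *)
  suff [i ir [TZ ex]] : exists2 i, (i < r)%N & aff_subset (Y k) (Z i) /\
      exists2 y, Z i y & y <> (fun=> 0).
    exists (fun i' => if (i' <= k)%N then Y i' else Z i); split.
      move=> i' _; case: leqP => [i'k|_]; last exact: Zirr.
      by have [? YW] := Yirr i' i'k; split=> // x /YW[].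
    move=> i'; rewrite [size _]/= -/k ltnS leq_eqVlt => /predU1P[->|i'k].
      rewrite eqxx ltnn; split=> //; exists (pt i).
      split; first by case: (ptP i ex).
      by move=> /TW[_ /eqP]; apply/negP/lpt.
    by rewrite i'k orbT; apply: Ylt.
  have [||i ir TZ] := @zirr_bigU _ _ (Y k) r Z irrT.
  + by move=> i /Zirr[/zirr_closed].
  + by move=> x /TW[/Zcov].
  have [ex|nex] := pselect (exists2 y, Z i y & y <> (fun=> 0)); first by exists i.
  (* In the remaining case the top of the chain is the origin alone. The piece containing [t x0] for
     a generic nonzero [t] passes through the origin and has a nonzero point. *)
  have T0 x : Y k x -> x = (fun=> 0).
    by move=> /TZ Zx; apply: contrapT => xN; apply: nex; exists x.
  have [|q q0 qP] := @line_meets x0 r Z; first by move=> i' /Zirr[/zirr_closed].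
  have /closed_nonrootP[t] : 'X * q != 0 by rewrite mulf_neq0 ?polyX_eq0.
  rewrite /root hornerM hornerX mulf_eq0 negb_or => /andP[t0 qt].
  have [i' i'r Zt] := Zcov _ (Vcone t _ Vx0).
  exists i' => //; split; first by move=> x /T0 ->; apply: qP Zt.
  exists (fun j => t * x0 j) => // E; have [j xj] := x0j _ x0N.
  have /eqP := congr1 (fun f => f j) E.
  by rewrite mulf_eq0 (negPf t0) (negPf xj).
- move=> x Vx lx; apply: lsN => [|l' l'ls]; last by apply: lx; rewrite inE l'ls orbT.
  by split=> //; apply: lx; rewrite mem_head.
Qed.

End Cones.

(** * Growth of function spaces along chains *)

Section Growth.

Variables (K : fieldType) (m : nat).
Implicit Types (V W Z : aff_pt K m -> Prop) (p q f h : {mpoly K[m]}).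

(** As [msize] is the degree plus one, and 0 for the zero polynomial, [msize p <= a.+1] expresses
    that the degree is at most [a], zero included. *)
Lemma msizeM_leq p q a b :
  (msize p <= a.+1)%N -> (msize q <= b.+1)%N -> (msize (p * q) <= (a + b).+1)%N.
Proof.
have [->|p0] := eqVneq p 0; first by rewrite mul0r msize0.
have [->|q0] := eqVneq q 0; first by rewrite mulr0 msize0.
by rewrite msizeM // => pa qb; rewrite -subn1 leq_subLR add1n -addSn -addnS leq_add.
Qed.

Lemma msizeX_leq p a k : (msize p <= a.+1)%N -> (msize (p ^+ k) <= (a * k).+1)%N.
Proof.
move=> pa; elim: k => [|k IH]; first by rewrite expr0 msize1.
by rewrite exprS mulnS; apply: msizeM_leq.
Qed.

Definition indep_on Z (T : finType) (p : T -> {mpoly K[m]}) :=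
  forall c : T -> K, vanishing Z (\sum_t c t *: p t) -> forall t, c t = 0.

Definition spans W (T : finType) (q : T -> {mpoly K[m]}) p :=
  exists c : T -> K, forall x, W x -> p.@[x] = \sum_t c t * (q t).@[x].

Lemma indep_span_card Z (T U : finType) (p : T -> {mpoly K[m]}) (q : U -> {mpoly K[m]}) :
  indep_on Z p -> (forall t, spans Z q (p t)) -> (#|T| <= #|U|)%N.
Proof.
move=> ip /choice[A AP]; rewrite leqNgt; apply/negP => UT.
have [c [[t ct] cA]] := linear_dependence A UT.
move/eqP: ct; apply; apply: ip => x Zx; rewrite raddf_sum /=.
under eq_bigr => s _ do rewrite mevalZ (AP s x Zx) mulr_sumr.
rewrite exchange_big /= big1 // => u _.
under eq_bigr => s _ do rewrite mulrA.
by rewrite -mulr_suml cA mul0r.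
Qed.

Lemma indep_mul Z (T : finType) (p : T -> {mpoly K[m]}) h :
  zirreducible Z -> ~ vanishing Z h -> indep_on Z p -> indep_on Z (fun t => h * p t).
Proof.
move=> irrZ nh ip c cv; apply: ip.
suff /(zirr_prime irrZ)[//|//] : vanishing Z (h * \sum_t c t *: p t).
by rewrite mulr_sumr; under eq_bigr => t _ do rewrite -scalerAr.
Qed.

(** In a relation whose coefficients at the powers of [f] below [j'] vanish, cancel [f ^+ j'], as
    irreducibility of [Z] allows, and restrict to [Z']. There [f] is 0, so only the terms that
    contained exactly [f ^+ j'] survive, and independence on [Z'] kills them. *)
Lemma indep_powers Z Z' (T : finType) (p : T -> {mpoly K[m]}) f (E : nat) :
  zirreducible Z -> aff_subset Z' Z -> vanishing Z' f -> ~ vanishing Z f ->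
  indep_on Z' p -> indep_on Z (fun u : T * 'I_E => f ^+ u.2 * p u.1).
Proof.
move=> irrZ Z'Z Z'f nZf ip c cv [t j].
suff /(_ j (leqnn j)) : forall j' : 'I_E, (j' <= j)%N -> forall t, c (t, j') = 0 by [].
have [k] := ubnP j; elim: k j {t} => // k IH j jk j' j'j.
have {}IH (i : 'I_E) t : (i < j')%N -> c (t, i) = 0.
  by move=> ij; apply: (IH i) => //; apply: leq_trans ij _; rewrite -ltnS (leq_trans _ jk).
move=> t; apply: (ip (fun t => c (t, j'))) => x Z'x.
pose S := \sum_(u : T * 'I_E | (j' <= u.2)%N) c u *: (f ^+ (u.2 - j') * p u.1).
have ZS : vanishing Z S.
  suff /(zirr_prime irrZ)[/(zirr_expr irrZ)//|//] : vanishing Z (f ^+ j' * S).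
  move=> y Zy; rewrite -(cv y Zy); congr meval; rewrite mulr_sumr big_mkcond.
  apply: eq_bigr => -[s i] _ /=; case: leqP => [ji|/IH ->]; last by rewrite scale0r.
  by rewrite -scalerAr mulrA -exprD subnKC.
rewrite -(ZS x (Z'Z x Z'x)) /S !raddf_sum /=.
rewrite [RHS](bigID (fun u => u.2 == j')) /= [X in _ + X]big1 ?addr0; last first.
  move=> [s i] /andP[/= ji ij]; rewrite mevalZ mevalM rmorphXn /= Z'f // expr0n subn_eq0.
  by rewrite leqNgt ltn_neqAle eq_sym ij ji mul0r mulr0.
rewrite (reindex_onto (fun t => (t, j')) fst) /=; last first.
  by move=> [s i] /andP[_ /eqP/= ->].
apply: eq_big => s; first by rewrite leqnn !eqxx.
by move=> _; rewrite subnn expr0 mul1r.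
Qed.

(** A lower bound of order [k] for the Hilbert function of [Z], with [e] as a linear rescaling of
    the degree. *)
Definition growth Z k := exists e, forall E, exists (T : finType) (p : T -> {mpoly K[m]}),
  [/\ #|T| = (E.+1 ^ k)%N, indep_on Z p & forall t, (msize (p t) <= (e * E).+1)%N].

(** Each step of the chain supplies an [f] as in [indep_powers]; its powers up to [E] multiply the
    number of independent functions by [E.+1]. *)
Lemma chain_growth V k : irr_chain V k ->
  exists Z, [/\ zirreducible Z, aff_subset Z V & growth Z k].
Proof.
move=> [Z [Zirr Zlt]]; exists (Z k); have [? ?] := Zirr k (leqnn k); split=> //.
suff : forall i, (i <= k)%N -> growth (Z i) i by apply.
elim=> [|i IH] ik.
  exists 0%N => E; exists unit, (fun=> 1); split=> [||t]; last by rewrite msize1.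
    by rewrite card_unit expn0.
  move=> c cv []; have [[_ [x Zx] _] _] := Zirr 0%N ik.
  have := cv x Zx; rewrite raddf_sum /= (bigD1 tt) //= big1 => [|[]//].
  by rewrite addr0 mevalZ meval1 mulr1.
have [e eP] := IH (ltnW ik); have [ZZ [x [Zx nZx]]] := Zlt i ik.
have [[cZi _ _] _] := Zirr i (ltnW ik); have [irrZ _] := Zirr i.+1 ik.
have [f Zf /eqP fx] := zclosed_neg cZi nZx.
exists (e + msize f)%N => E; have [T [p [cT ip sp]]] := eP E.
exists (T * 'I_E.+1)%type, (fun u : T * 'I_E.+1 => f ^+ u.2 * p u.1); split.
- by rewrite card_prod cT card_ord expnSr.
- by apply: indep_powers ip => // /(_ x Zx).
- move=> [t j] /=; rewrite mulnDl addnC.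
  apply: leq_trans (msizeM_leq (msizeX_leq j (leqnSn (msize f))) (sp t)) _.
  by rewrite ltnS leq_add2r leq_mul2l -ltnS ltn_ord orbT.
Qed.

(** Multiplication by a power of [h] preserves independence on [Z], so upper bounds may be proved
    after clearing denominators. Comparing both counts for a large [E] gives the inequality. *)
Lemma growth_le Z k t C A h : zirreducible Z -> growth Z k -> ~ vanishing Z h ->
  (forall D, exists (U : finType) (q : U -> {mpoly K[m]}),
     (#|U| <= C * (A * D).+1 ^ t)%N /\
     forall p, (msize p <= D.+1)%N -> spans Z q (h ^+ D * p)) ->
  (k <= t)%N.
Proof.
move=> irrZ [e eP] nh sp; rewrite leqNgt; apply/negP => tk.
(* With D = eE one has AD + 1 <= (Ae + 1)(E + 1), so the spanning family has at most E (E + 1)^t <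
   (E + 1)^(t + 1) members. *)
pose E := (C * (A * e).+1 ^ t)%N.
have [T [p [cT ip szp]]] := eP E; have [U [q [cU spq]]] := sp (e * E)%N.
have nhE : ~ vanishing Z (h ^+ (e * E)) by move/(zirr_expr irrZ).
have := indep_span_card (indep_mul irrZ nhE ip) (fun t => spq _ (szp t)).
rewrite cT leqNgt => /negP; apply; apply: leq_ltn_trans cU _.
apply: (@leq_trans (E.+1 ^ t.+1)); last by rewrite leq_pexp2l.
rewrite expnS; apply: (@leq_ltn_trans (E * E.+1 ^ t)); last first.
  by rewrite ltn_mul2r expn_gt0 ltnSn.
rewrite {2}/E -mulnA -expnMn leq_mul2l; apply/orP; right.
have leX a b : (a <= b -> a ^ t <= b ^ t)%N.
  by move=> ab; case: (posnP t) => [->//|t0]; rewrite leq_exp2r.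
by apply: leX; rewrite mulnA mulSn mulnS; lia.
Qed.

Lemma spansD W (T : finType) (q : T -> {mpoly K[m]}) p1 p2 :
  spans W q p1 -> spans W q p2 -> spans W q (p1 + p2).
Proof.
move=> [c1 c1P] [c2 c2P]; exists (fun t => c1 t + c2 t) => x Wx.
by rewrite mevalD c1P // c2P // -big_split; apply: eq_bigr => t _; rewrite mulrDl.
Qed.

Lemma spansZ W (T : finType) (q : T -> {mpoly K[m]}) c p :
  spans W q p -> spans W q (c *: p).
Proof.
move=> [c1 c1P]; exists (fun t => c * c1 t) => x Wx.
by rewrite mevalZ c1P // mulr_sumr; apply: eq_bigr => t _; rewrite mulrA.
Qed.

Lemma spans0 W (T : finType) (q : T -> {mpoly K[m]}) : spans W q 0.
Proof. by exists (fun=> 0) => x _; rewrite meval0 big1 // => t _; rewrite mul0r. Qed.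

Lemma spans_sum W (T : finType) (q : T -> {mpoly K[m]}) (I : eqType) (r : seq I)
    (F : I -> {mpoly K[m]}) :
  (forall i, i \in r -> spans W q (F i)) -> spans W q (\sum_(i <- r) F i).
Proof.
move=> FP; rewrite big_seq; apply: big_ind => //; first exact: spans0.
by move=> *; apply: spansD.
Qed.

Lemma spans_eq W (T : finType) (q : T -> {mpoly K[m]}) p1 p2 :
  (forall x, W x -> p1.@[x] = p2.@[x]) -> spans W q p1 -> spans W q p2.
Proof. by move=> E [c cP]; exists c => x Wx; rewrite -E // cP. Qed.

Lemma spans_mem W (T : finType) (q : T -> {mpoly K[m]}) t : spans W q (q t).
Proof.
exists (fun s => (s == t)%:R) => x _; rewrite (bigD1 t) //= eqxx mul1r big1 ?addr0 //.
by move=> s /negPf ->; rewrite mul0r.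
Qed.

Lemma spansM W (T U : finType) (q : T -> {mpoly K[m]}) (q' : U -> {mpoly K[m]}) p h :
  spans W q p -> (forall t, spans W q' (q t * h)) -> spans W q' (p * h).
Proof.
move=> [c cP] qh; apply: (@spans_eq _ _ _ (\sum_t c t *: (q t * h))).
  move=> x Wx; rewrite mevalM cP // raddf_sum mulr_suml.
  by apply: eq_bigr => t _ /=; rewrite mevalZ mevalM mulrA.
by apply: spans_sum => t _; apply: spansZ.
Qed.

(* Nakayama-style: rewriting [x_i ^+ N.+1] as [\sum_t Q i t * g t] lowers the degree. *)
Lemma finite_span W (T : finType) (g : T -> {mpoly K[m]}) (N : nat)
    (Q : 'I_m -> T -> {mpoly K[m]}) :
  (forall i t, (msize (Q i t) <= N.+1)%N) ->
  (forall i x, W x -> x i ^+ N.+1 = \sum_t (Q i t).@[x] * (g t).@[x]) ->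
  forall D p, (msize p <= D.+1)%N ->
  spans W (fun u : {ffun 'I_m -> 'I_N.+1} * {ffun T -> 'I_D.+1} =>
     (\prod_i 'X_i ^+ u.1 i) * \prod_t g t ^+ u.2 t) p.
Proof.
move=> szQ QP; elim=> [|D IH] p szp; rewrite [p]mpolyE; apply: spans_sum => u up;
  apply: spansZ; have := leq_trans (msize_mdeg_lt up) szp; rewrite ltnS => {p szp up} uD.
  have -> : u = 0%MM by apply/eqP; rewrite -mdeg_eq0 -leqn0.
  apply: spans_eq (spans_mem _ _ ([ffun=> ord0], [ffun=> ord0])) => x _ /=.
  rewrite mpolyX0 big1 ?mul1r => [|i _]; last by rewrite ffunE expr0.
  by rewrite big1 // => i _; rewrite ffunE expr0.
have [uN|/existsNP[i /negP]] := pselect (forall i, u i < N.+1)%N.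
  apply: spans_eq (spans_mem _ _ ([ffun i => inord (u i)], [ffun=> ord0])) => x _ /=.
  rewrite [X in _ * X]big1 ?mulr1 => [|i _]; last by rewrite ffunE expr0.
  rewrite mpolyXE_id; congr meval; apply: eq_bigr => i _.
  by rewrite ffunE inordK.
rewrite -leqNgt => Nu.
pose v := (u - U_(i) *+ N.+1)%MM.
have uE : u = (v + U_(i) *+ N.+1)%MM.
  rewrite submK //; apply/mnm_lepP => j; rewrite mulmnE mnm1E.
  by case: eqP => [<-|_]; rewrite ?mul1n.
(* The monomial loses degree [N.+1] and [Q i t] restores at most [N]: every new factor [g t] costs
   at least one degree, so [D.+1] bounds its exponents. *)
have vD : (mdeg v + N <= D)%N.
  by move: uD; rewrite uE mdegD mdegMn mdeg1 mul1n addnS ltnS.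
apply: (@spans_eq _ _ _ (\sum_t ('X_[v] * Q i t) * g t)).
  move=> x Wx; rewrite uE mpolyXD -mpolyXn mevalM rmorphXn /= mevalXU QP // mulr_sumr.
  by rewrite raddf_sum; apply: eq_bigr => t _; rewrite /= !mevalM mulrA.
apply: spans_sum => t _; apply: spansM (IH ('X_[v] * Q i t) _) _.
  have szv : (msize ('X_[v] : {mpoly K[m]}) <= (mdeg v).+1)%N by rewrite msizeX.
  by apply: leq_trans (msizeM_leq szv (szQ i t)) _; rewrite ltnS.
move=> w; apply: spans_eq (spans_mem _ _
  (w.1, [ffun s => inord (w.2 s + (s == t))] : {ffun T -> 'I_D.+2})) => x _ /=.
rewrite -mulrA; congr ((_ * _).@[_]).
rewrite [RHS]mulrC [LHS](bigD1 t) //= [in RHS](bigD1 t) //= mulrA.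
have wD s : (w.2 s + (s == t) < D.+2)%N.
  by move: (ltn_ord (w.2 s)); case: (s == t); move: (nat_of_ord _); lia.
congr (_ * _); first by rewrite ffunE inordK // eqxx addn1 exprS.
by apply: eq_bigr => s /negPf st; rewrite ffunE inordK // st addn0.
Qed.

End Growth.

(** * Homogeneous Nullstellensatz with degree bounds *)

Section HomogeneousNullstellensatz.

Variables (K : closedFieldType) (n : nat).
Hypothesis uncountable : large_fibre K.

Lemma dhomog_msize_leq (p : {mpoly K[n]}) d : p \is d.-homog -> (msize p <= d.+1)%N.
Proof.
by move=> /dhomogP hp; rewrite msizeE; apply/bigmax_leqP_seq => u /hp /= ->.
Qed.

Lemma pihomogM (q g : {mpoly K[n]}) d k : g \is d.-homog ->
  pihomog mdeg k (q * g) = if (d <= k)%N then pihomog mdeg (k - d) q * g else 0.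
Proof.
move=> hg; elim/mpolyind: q => [|c u q _ _ IH].
  by rewrite mul0r !raddf0 mul0r; case: ifP.
rewrite mulrDl !raddfD /= IH -scalerAl !linearZ /= pihomogX.
have hug : 'X_[u] * g \is (mdeg u + d).-homog by apply: dhomogM => //; rewrite dhomogX.
have [<-|kn] := eqVneq (mdeg u + d)%N k.
  by rewrite pihomog_dE // leq_addl addnK eqxx mulrDl -scalerAl.
rewrite (pihomog_ne0 kn hug) scaler0 add0r; case: leqP => // dk.
by rewrite -(eqn_add2r d) subnK // (negPf kn) scaler0 add0r.
Qed.

(** The Nullstellensatz gives a power of each variable; after passing to a common exponent, take
    homogeneous components. As the [g t] have positive degree, the coefficients have degree strictly
    below that exponent, as [finite_span] requires. *)
Lemma homogeneous_nullstellensatz (T : finType) (g : T -> {mpoly K[n]}) (d : T -> nat) :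
  (forall t, g t \is (d t).+1.-homog) ->
  (forall x : aff_pt K n, (forall t, (g t).@[x] = 0) -> x = (fun=> 0)) ->
  exists N (Q : 'I_n -> T -> {mpoly K[n]}),
    (forall i t, (msize (Q i t) <= N.+1)%N) /\
    forall i, 'X_i ^+ N.+1 = \sum_t Q i t * g t.
Proof.
move=> hg g0.
have /choice[N /choice[q qP]] : forall i, exists Ni (q : T -> {mpoly K[n]}),
    'X_i ^+ Ni = \sum_t q t * g t.
  by move=> i; apply: nullstellensatz => // x /g0 ->; rewrite mevalXU.
pose M := \max_i N i.
have NM i : (N i <= M)%N by apply: (leq_bigmax_cond (F := N) i).
(* A generator of degree above [M.+1] contributes nothing to the component of degree [M.+1]. *)
exists M, (fun i t => if (d t < M.+1)%N then
   pihomog mdeg (M.+1 - (d t).+1) ('X_i ^+ (M.+1 - N i) * q i t) else 0).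
split=> [i t|i].
  case: ifP => dM; last by rewrite msize0.
  by apply: leq_trans (dhomog_msize_leq (pihomogP _ _ _)) _; rewrite subSS ltnS leq_subr.
have hX : 'X_i ^+ M.+1 \is [in K[n], (M.+1).-homog].
  by rewrite -[X in X.-homog]mul1n; apply: dhomogMn; rewrite dhomogX /= mdeg1.
have XE : 'X_i ^+ M.+1 = \sum_t 'X_i ^+ (M.+1 - N i) * q i t * g t.
  under eq_bigr do rewrite -mulrA.
  by rewrite -mulr_sumr -qP -exprD subnK // (leq_trans (NM i)).
rewrite -[LHS](pihomog_dE hX) XE raddf_sum; apply: eq_bigr => t _ /=.
by rewrite (pihomogM _ _ (hg t)); case: ifP => // _; rewrite mul0r.
Qed.

End HomogeneousNullstellensatz.

(** * The two growth bounds on an irreducible subset *)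

Section BihomogeneousBound.

Variables (K : closedFieldType) (n m : nat).
Hypothesis uncountable : large_fibre K.
Variables (phi : 'I_n + 'I_n -> 'I_m) (f : 'I_n -> {mpoly K[n]}) (e : nat).
Hypotheses (phi_bij : bijective phi) (f_homog : forall j, f j \is e.+1.-homog).
Variables (Z : aff_pt K m -> Prop) (k : nat) (ls : seq {mpoly K[n]}).
Hypotheses (irrZ : zirreducible Z) (growthZ : growth Z k).
Hypotheses (ls_homog : forall l, l \in ls -> l \is 1.-homog)
  (ls_cut : forall z : aff_pt K n, (forall j, (f j).@[z] = 0) ->
     (forall l, l \in ls -> l.@[z] = 0) -> z = (fun=> 0)).

(** The labelling [phi] decides which coordinates play the roles of x and y, so that exchanging them
    covers the second variety as well. *)
Let X j := phi (inl j).
Let Y j := phi (inr j).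
Let zpt (x : aff_pt K m) : aff_pt K n := fun j => x (X j) * x (Y j).

Hypothesis Zf : forall x j, Z x -> x (Y j) * (f j).@[zpt x] = 0.

Let big_phi (R : Type) (idx : R) (op : Monoid.com_law idx) (F : 'I_m -> R) :
  \big[op/idx]_i F i = op (\big[op/idx]_j F (X j)) (\big[op/idx]_j F (Y j)).
Proof. by rewrite (reindex phi) /=; [rewrite big_sumType | apply: onW_bij]. Qed.

Let I := [set j : 'I_n | `[< vanishing Z 'X_(Y j) >]].

Let Y_eq0 j x : j \in I -> Z x -> x (Y j) = 0.
Proof. by rewrite inE => /asboolP Yj Zx; rewrite -[RHS](Yj x Zx) mevalXU. Qed.

Lemma growth_coord_le : (k <= n + #|~: I|)%N.
Proof.
pose T := ('I_n + 'I_#|~: I|)%type.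
pose h (t : T) : 'I_m := match t with inl j => X j | inr i => Y (enum_val i) end.
apply: (@growth_le _ _ Z k (n + #|~: I|) 1 1 1) => //.
  by case: irrZ => _ [x Zx] _ /(_ x Zx)/eqP; rewrite meval1 oner_eq0.
(* With exponent [N = 0], every coordinate is, on [Z], a constant combination of the x_j and of the
   y_j with j outside [I]; the spanning family consists of the monomials in these. *)
move=> D; have := @finite_span K m Z T (fun t => 'X_(h t)) 0
  (fun i t => if i == h t then 1 else 0) _ _ D.
set q := (X in (forall p, _ -> spans Z X p)) => sp; exists _, q; split.
  by rewrite card_prod !card_ffun card_sum !card_ord exp1n !mul1n.
move=> p szp; rewrite expr1n mul1r; apply: sp szp => [i t|i x Zx].
  by case: ifP; rewrite ?msize1 ?msize0.
rewrite big_sumType /= expr1 -(big_enum_val (A := mem (~: I))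
   (fun j => (if i == Y j then 1 else 0 : {mpoly K[m]}).@[x] * ('X_(Y j)).@[x])) /=.
have -> : x i = \sum_i' (i == i')%:R * x i'.
  rewrite (bigD1 i) //= eqxx mul1r big1 ?addr0 // => i' /negPf.
  by rewrite eq_sym => ->; rewrite mul0r.
rewrite big_phi /=; congr (_ + _).
  by apply: eq_bigr => j _; rewrite mevalXU; case: ifP; rewrite ?meval1 ?meval0.
rewrite [RHS]big_mkcond; apply: eq_bigr => j _ /=; rewrite inE.
case: ifPn => [_|]; last by rewrite negbK => /Y_eq0 ->; rewrite ?mulr0.
by rewrite mevalXU; case: ifP; rewrite ?meval1 ?meval0.
Qed.

(** The product of y_j and f_j(z) vanishes on the irreducible [Z], and y_j does not. *)
Lemma f_vanish j x : j \notin I -> Z x -> (f j).@[zpt x] = 0.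
Proof.
rewrite inE => /asboolPn nYj Zx.
pose zt := [tuple 'X_(X j) * 'X_(Y j) : {mpoly K[m]} | j < n].
have ztE y : (f j \mPo zt).@[y] = (f j).@[zpt y].
  rewrite comp_mpoly_meval; apply: meval_eq => i.
  by rewrite tnth_mktuple mevalM !mevalXU.
suff /(zirr_prime irrZ)[//|/(_ x Zx)] : vanishing Z ('X_(Y j) * (f j \mPo zt)).
  by rewrite ztE.
by move=> y Zy; rewrite mevalM mevalXU ztE Zf.
Qed.

(** After multiplication by [h ^+ D], a function of degree at most [D] is a combination of monomials
    in the [v j] times polynomials in z; [finite_span] controls the latter. *)
Lemma growth_product_le : (k <= n + (size ls + #|I|))%N.
Proof.
pose T0 := ('I_(size ls) + 'I_n)%type.
pose g0 (t : T0) := match t with inl i => ls`_i | inr j => f j end.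
have [|z g0z|N [Q [szQ QE]]] := @homogeneous_nullstellensatz K n uncountable T0 g0
  (fun t => match t with inl _ => 0%N | inr _ => e end).
- by case=> [i|j] /=; [apply: ls_homog; rewrite mem_nth | apply: f_homog].
- apply: ls_cut => [j|l /(nthP 0)[i ils <-]]; first exact: (g0z (inr j)).
  exact: (g0z (inl (Ordinal ils))).
pose W (z : aff_pt K n) := exists2 x, Z x & z = zpt x.
(* Only the [f j] with [j] in [I] are kept as generators: the others vanish on [W]. This brings the
   exponent down to [size ls + #|I|]. *)
pose T := ('I_(size ls) + 'I_#|I|)%type.
pose i0 (t : T) : T0 := match t with inl i => inl i | inr i => inr (enum_val i) end.
have fin D p := @finite_span K n W T (g0 \o i0) N (fun i t => Q i (i0 t))
  (fun i t => szQ i (i0 t)) _ D p.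
have {}fin D p : (msize p <= D.+1)%N ->
  spans W (fun u : {ffun 'I_n -> 'I_N.+1} * {ffun T -> 'I_D.+1} =>
     (\prod_i 'X_i ^+ u.1 i) * \prod_t (g0 \o i0) t ^+ u.2 t) p.
  apply: fin => i _ [x Zx ->].
  have <- : ('X_i ^+ N.+1).@[zpt x] = zpt x i ^+ N.+1 by rewrite rmorphXn /= mevalXU.
  rewrite QE raddf_sum /= !big_sumType /=; congr (_ + _).
    by apply: eq_bigr => j _; rewrite mevalM.
  rewrite -(big_enum_val (A := mem I) (fun j => (Q i (inr j)).@[zpt x] * (f j).@[zpt x])).
  rewrite [RHS]big_mkcond; apply: eq_bigr => j _ /=; rewrite mevalM.
  by case: ifPn => // jI; rewrite f_vanish ?mulr0.
pose zt := [tuple 'X_(X j) * 'X_(Y j) : {mpoly K[m]} | j < n].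
have ztE p y : (p \mPo zt).@[y] = p.@[zpt y].
  rewrite comp_mpoly_meval; apply: meval_eq => i.
  by rewrite tnth_mktuple mevalM !mevalXU.
pose h : {mpoly K[m]} := \prod_(j | j \notin I) 'X_(Y j).
pose v j : {mpoly K[m]} := if j \in I then 'X_(X j) else 'X_(Y j).
(* The constant [N.+1 ^ n] counts the bounded exponents of z; the factor 2 comes from exponents of
   the [v j] up to [2 * D]. *)
apply: (@growth_le _ _ Z k _ (N.+1 ^ n) 2 h) => //.
  rewrite /h; elim/big_rec: _ => [|j p jI IH].
    by case: irrZ => _ [x Zx] _ /(_ x Zx)/eqP; rewrite meval1 oner_eq0.
  by move/(zirr_prime irrZ) => -[] //; move: jI; rewrite inE => /asboolPn.
move=> D; pose U := ({ffun 'I_n -> 'I_(2 * D).+1} *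
  ({ffun 'I_n -> 'I_N.+1} * {ffun T -> 'I_D.+1}))%type.
pose B (u : {ffun 'I_n -> 'I_N.+1} * {ffun T -> 'I_D.+1}) : {mpoly K[m]} :=
  ((\prod_i 'X_i ^+ u.1 i) * \prod_t (g0 \o i0) t ^+ u.2 t) \mPo zt.
exists U, (fun u : U => (\prod_j v j ^+ u.1 j) * B u.2); split.
  rewrite !card_prod !card_ffun card_sum !card_ord mulnCA leq_mul //.
  rewrite [X in (_ <= X)%N]expnD leq_mul //.
  have [->//|T_gt0] := posnP (size ls + #|I|).
  by rewrite leq_exp2r // ltnS leq_pmull.
move=> p szp; rewrite [p]mpolyE mulr_sumr; apply: spans_sum => u up.
have uD : (mdeg u <= D)%N by rewrite -ltnS (leq_trans (msize_mdeg_lt up)).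
rewrite -scalerAr; apply: spansZ.
have uXD j : (u (X j) + u (Y j) <= D)%N.
  apply: leq_trans uD; rewrite mdegE big_phi /=.
  by apply: leq_add; rewrite (bigD1 j) //= leq_addr.
(* A monomial containing some y_j with j in [I] is zero on [Z]. *)
have [[j [jI uj]]|uI] := pselect (exists j, j \in I /\ (0 < u (Y j))%N).
  apply: spans_eq (spans0 _ _) => x Zx; rewrite meval0 mevalM mevalX big_phi /=.
  rewrite [X in _ * (_ * X)](bigD1 j) //= (Y_eq0 jI Zx) expr0n eqn0Ngt uj.
  by rewrite mul0r !mulr0.
(* For j outside [I], x_j^p y_j^q y_j^D = z_j^p y_j^(D - p + q), where p + q <= D; for j in [I] only
   x_j^p is present. The exponents of z form [a], the remaining ones form [c]. *)
pose a : 'X_{1..n} := [multinom if j \in I then 0%N else u (X j) | j < n].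
have aD : (msize ('X_[a] : {mpoly K[n]}) <= D.+1)%N.
  rewrite msizeX ltnS; apply: leq_trans uD; rewrite !mdegE big_phi /=.
  apply: leq_trans (leq_addr _ _); apply: leq_sum => j _.
  by rewrite mnmE; case: ifP.
pose c j := if j \in I then u (X j) else (D - u (X j) + u (Y j))%N.
have cD j : (c j < (2 * D).+1)%N.
  by have := uXD j; rewrite /c; case: ifP => _; lia.
have [b bP] := fin D _ aD.
apply: (@spans_eq _ _ _ _ _ (('X_[a] \mPo zt) * \prod_j v j ^+ c j)).
  move=> x Zx; rewrite !mevalM ztE !mevalX rmorphXn !rmorph_prod /= big_phi /=.
  rewrite -prodrXl [X in _ = X * _]big_mkcond -!big_split /=.
  apply: eq_bigr => j _; rewrite mnmE /v /c rmorphXn /=.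
  case: ifPn => [jI|jI]; rewrite !mevalXU.
    have -> : u (Y j) = 0%N.
      by apply/eqP; rewrite eqn0Ngt; apply/negP => uj; apply: uI; exists j.
    by rewrite !expr0 !mul1r mulr1.
  have uXj : (u (X j) <= D)%N by apply: leq_trans (uXD j); apply: leq_addr.
  rewrite /zpt -{2}(subnK uXj) exprMn !exprD [LHS]mulrACA [RHS]mulrACA.
  by congr (_ * _); rewrite mulrC.
apply: (@spansM _ _ _ _ _ B).
  exists b => x Zx; rewrite ztE bP; last by exists x.
  by apply: eq_bigr => w _; rewrite ztE.
move=> w; apply: spans_eq (spans_mem _ _ (([ffun j => inord (c j)], w) : U)) => x _ /=.
rewrite mulrC; congr ((_ * _).@[_]); apply: eq_bigr => j _.
by rewrite ffunE inordK.
Qed.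

Lemma growth_bihomogeneous_le : (2 * k <= 3 * n + size ls)%N.
Proof.
have := growth_coord_le; have := growth_product_le.
have := cardsC I; rewrite card_ord; lia.
Qed.

End BihomogeneousBound.

(** * Chain rule for composed polynomials *)

Section ChainRule.

Lemma mderivXU (R : nzRingType) (n : nat) (i k : 'I_n) :
  ('X_i : {mpoly R[n]})^`M(k) = (i == k)%:R.
Proof.
rewrite mderivX mnm1E; case: eqP => [->|_]; last by rewrite scale0r.
have -> : (U_(k) - U_(k) = 0 :> 'X_{1..n})%MM.
  by apply/mnmP => j; rewrite mnmBE mnm0E subnn.
by rewrite mpolyX0 scale1r.
Qed.

(** The identity holds for constants and variables and is stable under products and linear
    combinations. *)
Lemma mderiv_comp (R : comNzRingType) (n k : nat) (p : {mpoly R[n]})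
    (lq : n.-tuple {mpoly R[k]}) (i : 'I_k) :
  (p \mPo lq)^`M(i) = \sum_j (p^`M(j) \mPo lq) * (tnth lq j)^`M(i).
Proof.
pose P p := (p \mPo lq)^`M(i) = \sum_j (p^`M(j) \mPo lq) * (tnth lq j)^`M(i).
have P1 : P 1.
  rewrite /P comp_mpoly1 -mpolyC1 mderivC big1 // => j _.
  by rewrite mderivC comp_mpoly0 mul0r.
have PM p1 p2 : P p1 -> P p2 -> P (p1 * p2).
  rewrite /P rmorphM mderivM => -> ->; rewrite mulr_suml mulr_sumr -big_split /=.
  by apply: eq_bigr => j _; rewrite mderivM rmorphD !rmorphM /=; ring.
have PX j : P 'X_j.
  rewrite /P comp_mpolyXU (bigD1 j) //= mderivXU eqxx comp_mpoly1 mul1r.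
  rewrite big1 ?addr0 -?tnth_nth // => j' /negPf jj'.
  by rewrite mderivXU eq_sym jj' comp_mpoly0 mul0r.
rewrite -/(P p); elim/mpolyind: p => [|c m p _ _ IH].
  by rewrite /P comp_mpoly0 mderiv0 big1 // => j _; rewrite mderiv0 comp_mpoly0 mul0r.
have Pm : P 'X_[m].
  rewrite mpolyXE_id; elim/big_rec: _ => // j q _ Pq; apply: (PM) => //.
  by elim: (m j) => [|a IHa]; [rewrite expr0 | rewrite exprS; apply: (PM)].
rewrite /P comp_mpolyD comp_mpolyZ mderivD mderivZ Pm IH scaler_sumr -big_split /=.
by apply: eq_bigr => j _; rewrite mderivD mderivZ comp_mpolyD comp_mpolyZ mulrDl scalerAl.
Qed.

End ChainRule.

(** * Partial derivatives of F and G *)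

Section Derivatives.

Variables (K : numFieldType) (n : nat) (F : {mpoly int[n]}).

Lemma mpoly_intK_Gform : mpoly_intK K (Gform F) = mpoly_intK K F \mPo
  [tuple 'X_(lshift n i) * 'X_(rshift n i) : {mpoly K[n + n]} | i < n].
Proof.
rewrite /mpoly_intK /Gform (map_mpoly_comp _ _ (f := intr)) //; last exact: intr_inj.
congr (_ \mPo _); apply/eq_from_tnth => i.
by rewrite tnth_map !tnth_mktuple rmorphM /= !map_mpolyX.
Qed.

Lemma Gform_deriv1 (x : aff_pt K (n + n)) j :
  ((mpoly_intK K (Gform F))^`M(lshift n j)).@[x] =
  x (rshift n j) *
    ((mpoly_intK K F)^`M(j)).@[fun i => x (lshift n i) * x (rshift n i)].
Proof.
rewrite mpoly_intK_Gform mderiv_comp raddf_sum (bigD1 j) //= big1 ?addr0 => [|i ij].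
  rewrite tnth_mktuple mderivM !mderivXU eqxx eq_rlshift mul1r mulr0 addr0 mevalM mevalXU.
  rewrite mulrC comp_mpoly_meval; congr (_ * _); apply: meval_eq => i.
  by rewrite tnth_mktuple mevalM !mevalXU.
rewrite tnth_mktuple mderivM !mderivXU eq_rlshift (inj_eq (@lshift_inj _ _)) (negPf ij).
by rewrite mul0r mulr0 addr0 mulr0 meval0.
Qed.

Lemma Gform_deriv2 (x : aff_pt K (n + n)) j :
  ((mpoly_intK K (Gform F))^`M(rshift n j)).@[x] =
  x (lshift n j) *
    ((mpoly_intK K F)^`M(j)).@[fun i => x (lshift n i) * x (rshift n i)].
Proof.
rewrite mpoly_intK_Gform mderiv_comp raddf_sum (bigD1 j) //= big1 ?addr0 => [|i ij].
  rewrite tnth_mktuple mderivM !mderivXU eqxx eq_lrshift mul0r mulr1 add0r mevalM mevalXU.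
  rewrite mulrC comp_mpoly_meval; congr (_ * _); apply: meval_eq => i.
  by rewrite tnth_mktuple mevalM !mevalXU.
rewrite tnth_mktuple mderivM !mderivXU eq_lrshift (inj_eq (@rshift_inj _ _)) (negPf ij).
by rewrite mul0r mulr0 addr0 mulr0 meval0.
Qed.

Lemma deriv_homog e j : F \is e.+1.-homog -> (mpoly_intK K F)^`M(j) \is e.-homog.
Proof.
move=> hF; apply/dhomogP => u; rewrite mcoeff_msupp mcoeff_deriv.
rewrite (mcoeff_map_mpoly intr) => uF /=.
have /(dhomog_mf hF) /= : (u + U_(j))%MM \in msupp F.
  by rewrite mcoeff_msupp; apply: contraNneq uF => ->; rewrite mul0rn.
by rewrite mdegD mdeg1 addn1 => -[].
Qed.

End Derivatives.

(** * Chains and the dimension *)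

Section Dimension.

Variables (K : fieldType) (m : nat).
Implicit Types V : aff_pt K m -> Prop.

(** The maximum is attained unless there is no chain at all, in which case it defaults to 0. *)
Lemma zdim_chain V : zdim V = 0%N \/ irr_chain V (zdim V).
Proof.
rewrite /zdim; elim/big_ind: _ => [|a b ha hb|i /asboolP]; [by left| |by right].
by rewrite /maxn; case: ifP.
Qed.

(** A chain longer than [m] is truncated, since [zdim] ranges over lengths up to [m]. *)
Lemma zdim_ge V k : irr_chain V k -> (minn k m <= zdim V)%N.
Proof.
move=> [Z [Zirr Zlt]]; have km : (minn k m < m.+1)%N by rewrite ltnS geq_minr.
apply: (leq_bigmax_cond (F := @nat_of_ord _) (Ordinal km)); apply/asboolP.
exists Z; split=> i ik /=; first by apply: Zirr; apply: leq_trans ik (geq_minl _ _).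
by apply: Zlt; apply: leq_trans ik (geq_minl _ _).
Qed.

End Dimension.

(** * The codimension inequality *)

Lemma VFstar_cut (R : realType) (n e : nat) (F : {mpoly int[n]}) :
  F \is e.+2.-homog ->
  exists ls : seq {mpoly R[i][n]},
    [/\ forall l, l \in ls -> l \is 1.-homog,
        irr_chain (VFstar R[i] F) (size ls) &
        forall z : aff_pt R[i] n, (forall j, ((mpoly_intK R[i] F)^`M(j)).@[z] = 0) ->
          (forall l, l \in ls -> l.@[z] = 0) -> z = (fun=> 0)].
Proof.
move=> hF; have hD j : (mpoly_intK R[i] F)^`M(j) \is e.+1.-homog by apply: deriv_homog.
have scale (t : R[i]) x : VFstar R[i] F x -> VFstar R[i] F (fun j => t * x j).
  by move=> Vx _ [j ->]; rewrite (dhomog_meval _ _ (hD j)) Vx ?mulr0 //; exists j.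
(* The partial derivatives have degree [e.+1], which is positive, so they vanish at the origin. *)
have V0 : VFstar R[i] F (fun=> 0).
  move=> _ [j ->]; have := dhomog_meval 0 (fun=> 0) (hD j).
  by rewrite expr0n /= !mul0r.
have [|ls [ls1 lsV ls0]] := cone_cut _ V0 scale.
  by exists (fun p => exists j : 'I_n, p = (mpoly_intK R[i] F)^`M(j)).
by exists ls; split=> // z Vz; apply: ls0 => _ [j ->].
Qed.

Lemma zcodim_VFstar_le (R : realType) (n e : nat) (F : {mpoly int[n]})
    (phi : 'I_n + 'I_n -> 'I_(n + n)) (V : aff_pt R[i] (n + n) -> Prop) :
  F \is e.+2.-homog -> bijective phi ->
  (forall x j, V x -> x (phi (inr j)) *
     ((mpoly_intK R[i] F)^`M(j)).@[fun i => x (phi (inl i)) * x (phi (inr i))] = 0) ->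
  (zcodim (VFstar R[i] F) <= 2 * zcodim V)%N.
Proof.
move=> hF phi_bij VE; have [ls [ls1 lsV ls0]] := VFstar_cut R hF.
have lszd := zdim_ge lsV.
(* Subtraction is truncated: if [size ls] exceeds [n], then [lszd] makes the codimension of V*_F
   zero. *)
suff : (2 * zdim V <= 3 * n + size ls)%N by rewrite /zcodim; lia.
have [->|/chain_growth[Z [irrZ ZV gZ]]] := zdim_chain V; first by rewrite muln0.
apply: (growth_bihomogeneous_le (@uncountable_complex R) phi_bij
  (fun j => deriv_homog R[i] j hF) irrZ gZ ls1 ls0) => x j /ZV.
exact: VE.
Qed.

(* The complex numbers are R[i] for R : realType (any model of the reals). *)
Theorem theorem5p1 (R : realType) (n d : nat) (F : {mpoly int[n]}) :
  (1 < d)%N -> F \is d.-homog ->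
  ((zcodim (VFstar (complex R) F))%:R / 2 : rat)
    <= (minn (zcodim (VGstar1 (complex R) F)) (zcodim (VGstar2 (complex R) F)))%:R.
Proof.
case: d => [|[|e]] // _ hF.
rewrite ler_pdivrMr // -natrM ler_nat mulnC minnMr leq_min.
have unsplit_bij : bijective (@unsplit n n) by exists split; [exact: unsplitK|exact: splitK].
(* Exchanging x and y leaves the products z_j unchanged and turns the equations of the second
   variety into those of the first. *)
pose swap (u : 'I_n + 'I_n) : 'I_n + 'I_n :=
  match u with inl i => inr i | inr i => inl i end.
have swap_bij : bijective (@unsplit n n \o swap).
  by apply: bij_comp unsplit_bij _; exists swap; case.
apply/andP; split.
  apply: (zcodim_VFstar_le hF unsplit_bij) => x j Vx.
  by rewrite -Gform_deriv1; apply: Vx; exists j.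
apply: (zcodim_VFstar_le hF swap_bij) => x j Vx /=.
have := Vx _ (ex_intro _ j erefl); rewrite Gform_deriv2 => <-; congr (_ * _).
by apply: meval_eq => i; rewrite mulrC.
Qed.
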